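(* Let $P$ be a poset and let $Q=(\omega^{*}(P),\supseteq)$ be the family of all closed subsets of $(P,\omega(P))$ ordered by reverse inclusion. Then the following two conditions are equivalent: (1) $P$ has property R. (2) For any $U\in\sigma(P)$, the set $\Phi(U)=\{C\in\omega^{*}(P) : C\subseteq U\}$ belongs to $\sigma(Q)$.
   Context: For a poset $P$ and $A\subseteq P$, $\mathord{\uparrow}A=\{x\in P: x\ge a\text{ for some }a\in A\}$. A subset is directed if it is nonempty and any two of its elements have an upper bound in it. $U\subseteq P$ is Scott open if $U=\mathord{\uparrow}U$ and, for every directed $D\subseteq P$ such that $\bigvee D$ exists, $\bigvee D\in U$ implies $D\cap U\neq\emptyset$; $\sigma(P)$ is the resulting (Scott) topology. The lower topology $\omega(P)$ is generated by the subbase $\{P\setminus\mathord{\uparrow}x : x\in P\}$, and $\omega^{*}(P)$ is the family of all closed subsets of $(P,\omega(P))$, i.e. $\omega^{*}(P)=\{\emptyset,P\}\cup\{\bigcap\mathcal{F} : \mathcal{F}\subseteq\mathbf{Fin}\,P\}$, where $\mathbf{Fin}\,P=\{\mathord{\uparrow}F : F\subseteq P\text{ nonempty finite}\}$. $Q$ is a complete lattice whose suprema are intersections. $P$ has property R if for any family $\{\mathord{\uparrow}F_i : i\in I\}\subseteq\mathbf{Fin}\,P$ with $I\neq\emptyset$ and any $U\in\sigma(P)$, $\bigcap_{i\in I}\mathord{\uparrow}F_i\subseteq U$ implies $\bigcap_{i\in I_0}\mathord{\uparrow}F_i\subseteq U$ for some nonempty finite $I_0\subseteq I$. *)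

(* Defs.v *)
From HB Require Import structures.
From mathcomp Require Import all_boot all_order.
From mathcomp Require Import boolp classical_sets cardinality topology_structure.
Set Implicit Arguments.
Unset Strict Implicit.
Unset Printing Implicit Defensive.
Import Order.TTheory.
Local Open Scope classical_set_scope.
Local Open Scope order_scope.

Definition upset {d} {P : porderType d} (A : set P) : set P :=
  [set x | exists2 a, A a & a <= x].

Definition directed {d} {P : porderType d} (D : set P) : Prop :=
  D !=set0 /\
  forall x y, D x -> D y -> exists z, [/\ D z, x <= z & y <= z].

                                                                             
                          
Definition scott_open {d} {P : porderType d} (U : set P) : Prop :=
  U = upset U /\
  forall (D : set P) (s : P), directed D -> isLub D s -> U s -> D `&` U !=set0.

Lemma scott_openT {d} {P : porderType d} : scott_open [set: P].
Proof.
split; first by rewrite eqEsubset; split=> // x _; exists x.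
by move=> D s [[x Dx] _] _ _; exists x.
Qed.

Lemma scott_openI {d} {P : porderType d} : setI_closed (@scott_open d P).
Proof.
move=> A B [Aup Ao] [Bup Bo]; split.
  rewrite eqEsubset; split=> [x ABx|x [a [Aa Ba] ax]]; first by exists x.
  by split; [rewrite Aup|rewrite Bup]; exists a.
move=> D s dD Ds [As Bs].
have [x [Dx Ax]] := Ao D s dD Ds As; have [y [Dy By]] := Bo D s dD Ds Bs.
have [z [Dz xz yz]] := dD.2 x y Dx Dy; exists z; split=> //.
by split; [rewrite Aup; exists x|rewrite Bup; exists y].
Qed.

Lemma scott_open_bigcup {d} {P : porderType d} (I : Type) (f : I -> set P) :
  (forall i, scott_open (f i)) -> scott_open (\bigcup_i f i).
Proof.
move=> fo; split.
  rewrite eqEsubset; split=> [x fx|x [a [i _ fa] ax]]; first by exists x.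
  by exists i => //; rewrite (fo i).1; exists a.
move=> D s dD Ds [i _ fs]; have [x [Dx fx]] := (fo i).2 D s dD Ds fs.
by exists x; split=> //; exists i.
Qed.

                                                      
Definition scott {d} (P : porderType d) : Type := P.

HB.instance Definition _ {d} (P : porderType d) := Order.POrder.on (scott P).
HB.instance Definition _ {d} (P : porderType d) :=
  isOpenTopological.Build (scott P) (@scott_openT d P) (@scott_openI d P)
    (@scott_open_bigcup d P).

                                                                             
                                                                              
                 
Definition lower {d} (P : porderType d) : Type := P.

HB.instance Definition _ {d} (P : porderType d) := Order.POrder.on (lower P).
HB.instance Definition _ {d} (P : porderType d) :=
  isSubBaseTopological.Build (lower P)
    [set ~` upset [set x] | x in [set: P]] id.

                                               
Definition lower_closed {d} (P : porderType d) : Type :=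
  set_type (@closed (lower P)).

HB.instance Definition _ {d} (P : porderType d) :=
  Choice.on (lower_closed P).

Definition lower_closed_set {d} {P : porderType d} (C : lower_closed P) :
  set P := val C.

Definition lower_closed_le {d} {P : porderType d} (C D : lower_closed P) : bool :=
  `[< lower_closed_set D `<=` lower_closed_set C >].

Lemma lower_closed_le_refl {d} {P : porderType d} :
  reflexive (@lower_closed_le d P).
Proof. by move=> C; apply/asboolP. Qed.

Lemma lower_closed_le_anti {d} {P : porderType d} :
  antisymmetric (@lower_closed_le d P).
Proof.
move=> C D /andP[/asboolP DC /asboolP CD].
by apply/val_inj; rewrite eqEsubset; split.
Qed.

Lemma lower_closed_le_trans {d} {P : porderType d} :
  transitive (@lower_closed_le d P).
Proof.
by move=> C B D /asboolP CB /asboolP DC; apply/asboolP; apply: subset_trans CB.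
Qed.

Fact lower_closed_display (d : Order.disp_t) : Order.disp_t.
Proof. exact: d. Qed.

HB.instance Definition _ {d} (P : porderType d) :=
  Order.Le_isPOrder.Build (lower_closed_display d) (lower_closed P)
    (@lower_closed_le_refl d P) (@lower_closed_le_anti d P)
    (@lower_closed_le_trans d P).

Definition property_R {d} (P : porderType d) : Prop :=
  forall (I : Type) (F : I -> set P) (U : set P),
    inhabited I ->
    (forall i, finite_set (F i) /\ F i !=set0) ->
    @open (scott P) U ->
    \bigcap_i upset (F i) `<=` U ->
    exists I0 : set I, [/\ finite_set I0, I0 !=set0 &
      \bigcap_(i in I0) upset (F i) `<=` U].

Definition Phi {d} {P : porderType d} (U : set P) : set (lower_closed P) :=
  [set C | lower_closed_set C `<=` U].

(* Main.v *)
Require Import Defs.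
From mathcomp Require Import all_boot all_order.
From mathcomp Require Import finmap.
From mathcomp Require Import boolp classical_sets cardinality topology_structure.

(** Suprema in the poset of closed sets of the lower topology, ordered by
    reverse inclusion, are intersections, since an arbitrary intersection of closed sets is closed
    ([isLub_lower_closed]).  Hence Scott openness of [Phi U] says that [U]
    contains a member of every directed family of closed sets whose intersection
    it contains: a compactness property of closed sets.  Property R is the same
    property, stated for arbitrary families of finitely generated upper sets and
    their finite intersections.  The two kinds of families determine each other.

    From R to directed families: a nonempty closed set is the intersection of
    the finitely generated upper sets containing it
    ([lower_closed_separation]).  Apply R to all the generators [F] such that
    the upper set of [F] contains some member of the directed family; finitely
    many of them suffice, and directedness yields one member contained in all of
    their upper sets ([directed_finite_ub]).

    From directed families to R: finitely generated upper sets are closed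
    ([closed_upset_finite]), and the intersections over nonempty finite
    subfamilies form a directed family of closed sets with the same total
    intersection. *)

Local Open Scope order_scope.
Local Open Scope classical_set_scope.

Lemma directed_finite_ub {d} {T : porderType d} (D A : set T) :
  directed D -> finite_set A -> A `<=` D ->
  exists2 z, D z & forall x, A x -> x <= z.
Proof.
move=> [[x0 Dx0] dD] /finite_seqP[s ->].
elim: s => [|a s IHs] sD; first by exists x0.
have [|z Dz zs] := IHs;
  first by move=> x xs; apply: sD; rewrite /= in_cons xs orbT.
have [|w [Dw aw zw]] := dD a z _ Dz; first by apply: sD; rewrite /= mem_head.
exists w => // x /=; rewrite in_cons => /orP[/eqP->//|xs].
exact: Order.POrderTheory.le_trans (zs x xs) zw.
Qed.

Lemma closed_upset_finite {d} {P : porderType d} (F : set P) :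
  finite_set F -> @closed (lower P) (upset F).
Proof.
move=> finF.
have -> : upset F = \bigcup_(a in F) upset [set a].
  rewrite eqEsubset; split=> [x [a Fa ax]|x [a Fa [_ -> ax]]].
    by exists a => //; exists a.
  by exists a.
apply: (@closed_bigcup (lower P) P) => // a _.
rewrite -openC.
(* a subbasic set is the union of the one-member family of finite
   intersections of subbasic sets that consists of itself *)
exists [set ~` upset [set a]]; last by rewrite bigcup_set1.
move=> _ ->; apply: (@filter.finI_from1 _ _ _ id).
by exists a.
Qed.

(** The subbase generating the lower topology, as a description of its open
    sets on the carrier [P] itself. *)
Lemma open_lower_bigcup {d} {P : porderType d} (U : set P) :
  @open (lower P) U ->
  exists B : set (set P),
    B `<=` filter.finI_from [set ~` upset [set x] | x in [set: P]] id /\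
    U = \bigcup_(V in B) V.
Proof. by move=> [B sB <-]; exists B. Qed.

(** A basic neighbourhood of a point outside [C] is a finite intersection of
    complements of principal upper sets, so its complement is the upper set of
    finitely many points. *)
Lemma lower_closed_separation {d} {P : porderType d} (C : set P) (x : P) :
  @closed (lower P) C -> ~ C x ->
  exists F, [/\ finite_set F, C `<=` upset F & ~ upset F x].
Proof.
move=> /closed_openC/open_lower_bigcup[B [sB BC]] nCx.
have {}BC : ~` C = \bigcup_(V in B) V := BC.
have : (~` C) x by [].
rewrite BC => -[V BV Vx]; have [E sE EV] := sB V BV.
pose F : set P := [set a | (~` upset [set a]) \in E].
have EF (W : set P) : W \in E -> exists2 a, F a & W = ~` upset [set a].
  move=> EW; have := sE W EW; rewrite inE => -[a _ aW].
  by exists a; rewrite // /F /= aW.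
exists F; split.
- (* distinct points have distinct principal upper sets *)
  have finE : finite_set [set` E] by exact: finite_fset.
  apply: (finite_preimage (f := fun a : P => ~` upset [set a]) _ finE).
  move=> a b _ _ /= /(congr1 setC); rewrite !setCK => ab.
  have [_ -> ba] : upset [set b] a by rewrite -ab; exists a.
  have [_ -> ab'] : upset [set a] b by rewrite ab; exists b.
  by apply/Order.POrderTheory.le_anti; rewrite ab' ba.
- move=> y Cy; apply: contrapT => nFy.
  suff : (~` C) y by [].
  rewrite BC; exists V => //; rewrite -EV => W /= /EF[a Fa ->] [_ -> ay].
  by apply: nFy; exists a.
- move=> [a Fa ax]; move: Vx; rewrite -EV => /(_ _ Fa); apply.
  by exists a.
Qed.

Lemma isLub_lower_closed {d} {P : porderType d}
    (D : set (lower_closed P)) (S : lower_closed P) :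
  isLub D S <-> lower_closed_set S = \bigcap_(C in D) lower_closed_set C.
Proof.
have clI : @closed (lower P) (\bigcap_(C in D) lower_closed_set C).
  by apply: (@closed_bigI (lower P)) => C _; have := valP C; rewrite inE.
split=> [[ubS leS]|SE].
  rewrite eqEsubset; split=> [x Sx C DC|].
    by have /asboolP := ubS C DC; apply.
  have /asboolP : S <= SigSub (mem_set clI); last exact.
  by apply: leS => C DC; apply/asboolP => x; apply.
split=> [C DC|B ubB]; apply/asboolP; rewrite SE => x; first exact.
by move=> Bx C DC; have /asboolP := ubB C DC; apply.
Qed.

Lemma Phi_upset {d} {P : porderType d} (U : set P) : Phi U = upset (Phi U).
Proof.
rewrite eqEsubset; split=> [C CU|C [B BU /asboolP CB]]; first by exists C.
exact: subset_trans CB BU.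
Qed.

Lemma property_R_Phi_open {d} {P : porderType d} (U : set P) :
  property_R P -> scott_open U -> scott_open (Phi U).
Proof.
move=> RP oU; split; first exact: Phi_upset.
move=> D S dD /isLub_lower_closed SE; rewrite /Phi /= SE => DU.
(* property R speaks of nonempty generating sets; an empty closed set, which
   is cut out with the empty generating set, lies in any [U] *)
have [[C [DC C0]]|noempty] :=
  pselect (exists C, D C /\ lower_closed_set C = set0).
  by exists C; split=> //; rewrite /Phi /= C0.
pose good (F : set P) := [/\ finite_set F, F !=set0 &
  exists2 C, D C & lower_closed_set C `<=` upset F].
have sep C x : D C -> ~ lower_closed_set C x ->
    exists2 F, good F & ~ upset F x.
  move=> DC nCx; have clC : @closed (lower P) (lower_closed_set C).
    by have := valP C; rewrite inE.
  have [F [finF CF nFx]] := lower_closed_separation _ _ clC nCx.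
  exists F => //; split=> //; last by exists C.
  have [y Cy] : lower_closed_set C !=set0.
    by apply/set0P/eqP => C0; apply: noempty; exists C.
  by have [a Fa _] := CF y Cy; exists a.
have [[F0 gF0]|nogood] := pselect (exists F, good F); last first.
  (* without generators every member of the family is the whole poset *)
  have [C DC] := dD.1; exists C; split=> // x _; apply: DU => B DB.
  apply: contrapT => nBx; have [F gF _] := sep B x DB nBx.
  by apply: nogood; exists F.
pose I := {F : set P | good F}.
have /choice[g gP] (i : I) : exists C,
    D C /\ lower_closed_set C `<=` upset (sval i).
  by case: i => F [finF neF [C DC CF]]; exists C.
have [||||I0 [finI0 _ I0U]] := RP I sval U.
- by constructor; exists F0.
- by move=> [F []].
- exact: oU.
- move=> x Ix; apply: DU => C DC; apply: contrapT => nCx.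
  have [F gF nFx] := sep C x DC nCx.
  by apply: nFx; exact: (Ix (exist _ F gF)).
have [||C DC ubC] := @directed_finite_ub _ _ D (g @` I0) dD.
- exact: finite_image.
- by move=> _ [i _ <-]; have [] := gP i.
exists C; split=> // x Cx; apply: I0U => i I0i; apply: (gP i).2.
by have /asboolP := ubC (g i) (imageP _ I0i); apply.
Qed.

Lemma Phi_open_property_R {d} {P : porderType d} :
  (forall U : set P, scott_open U -> scott_open (Phi U)) -> property_R P.
Proof.
move=> PhiO I F U [i0] finF oU FU.
have clF (J : set I) : @closed (lower P) (\bigcap_(i in J) upset (F i)).
  apply: (@closed_bigI (lower P)) => i _.
  exact: closed_upset_finite (finF i).1.
pose cap J : lower_closed P := SigSub (mem_set (clF J)).
pose D := cap @` [set J | finite_set J /\ J !=set0].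
have dD : directed D.
  split; first by exists (cap [set i0]), [set i0] => //; split=> //; exists i0.
  move=> _ _ [J [fJ [j Jj]] <-] [K [fK _] <-].
  exists (cap (J `|` K)); split.
  - exists (J `|` K) => //; split; last by exists j; left.
    by rewrite finite_setU.
  - by apply/asboolP => x xJK i Ji; apply: xJK; left.
  - by apply/asboolP => x xJK i Ki; apply: xJK; right.
have lubD : isLub D (cap setT).
  apply/isLub_lower_closed; rewrite eqEsubset; split=> [x xT _ [J _ <-] i _|x xD i _].
    exact: xT.
  have Di : D (cap [set i]) by exists [set i] => //; split=> //; exists i.
  exact: xD _ Di i erefl.
have [_ [[J [fJ J0] <-] JU]] := (PhiO U oU).2 D _ dD lubD FU.
by exists J.
Qed.

Theorem lemma5p14 (d : Order.disp_t) (P : porderType d) :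
  property_R P <->
  (forall U : set P,
     @open (scott P) U -> @open (scott (lower_closed P)) (Phi U)).
Proof.
split=> [RP U oU|PhiO]; first exact: property_R_Phi_open.
exact: Phi_open_property_R.
Qed.
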